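(* Let $0\le\mu<L<\infty$, $\delta\in[0,\sqrt5-2)$ and $\epsilon\in\left(1-\frac{1-\delta}{(1+\delta)^2},\frac12\right)$. Let $f:\mathbb R^n\to\mathbb R$ be a $(\mu,L)$-smooth function with global minimizer $\mathbf x_*$ and let $\{\mathbf x_k\}_{k\ge1}$ be any sequence of iterates generated using noisy gradient descent with the Goldstein rule (with noise level $\delta$ and parameter $\epsilon$). Then for every $k\ge1$ the bound $$f_{k+1}-f_*\le\left(1-\frac{4\mu\epsilon(1-\delta)^2}{L}\left[\frac{1-\delta}{(1+\delta)^2}-(1-\epsilon)\right]\right)(f_k-f_* )$$ holds and admits an SOS certificate of degree 1 with respect to the valid constraints $h_1(\mathbf z)\ge0,\dots,h_7(\mathbf z)\ge0$ defined in the context.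
   Context: Notation: $f_i=f(\mathbf x_i)$ and $\mathbf g_i=\nabla f(\mathbf x_i)$ for $i\in\{k,k+1,*\}$; $\|\cdot\|$ is the Euclidean norm. Since $\mathbf x_*$ is a global minimizer, $\mathbf g_*=0$. $(\mu,L)$-smooth function: a convex differentiable $f:\mathbb R^n\to\mathbb R$ with $\|\nabla f(\mathbf x)-\nabla f(\mathbf y)\|\le L\|\mathbf x-\mathbf y\|$ for all $\mathbf x,\mathbf y$ ($L$-smooth) and $f(\mathbf x)-\frac\mu2\|\mathbf x\|^2$ convex ($\mu$-strongly convex). Noisy gradient descent with noise level $\delta$: $\mathbf x_{k+1}=\mathbf x_k+\gamma_k\mathbf d_k$, where $\gamma_k>0$ and the direction $\mathbf d_k\in\mathbb R^n$ satisfies $\|\mathbf d_k-(-\mathbf g_k)\|\le\delta\|\mathbf g_k\|$. Goldstein rule (noisy setting): the step size $\gamma_k$ satisfies $$-(1-\epsilon)\gamma_k\|\mathbf d_k\|^2\le f(\mathbf x_k+\gamma_k\mathbf d_k)-f(\mathbf x_k)\le-\epsilon\gamma_k\|\mathbf d_k\|^2 .$$ Constraint polynomials: let $\mathbf z=(f_*,f_k,f_{k+1},\mathbf x_*,\mathbf x_k,\mathbf x_{k+1},\mathbf g_*,\mathbf g_k,\mathbf g_{k+1})$, regarded as formal variables with $\mathbf g_*=0$ substituted. For $(i,j)$ put $$h_{(i,j)}(\mathbf z)=f_i-f_j-\mathbf g_j^\top(\mathbf x_i-\mathbf x_j)-\frac{L}{2(L-\mu)}\left(\frac1L\|\mathbf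 g_i-\mathbf g_j\|^2+\mu\|\mathbf x_i-\mathbf x_j\|^2-2\frac\mu L(\mathbf g_j-\mathbf g_i)^\top(\mathbf x_j-\mathbf x_i)\right).$$ Then $h_1,\dots,h_6$ are $h_{(i,j)}$ for $(i,j)=(k,k+1),(k,* ),(k+1,k),(k+1,* ),( *,k),( *,k+1)$ respectively; the inequalities $h_1,\dots,h_6\ge0$ are the interpolability conditions satisfied by every $(\mu,L)$-smooth function. The seventh is $$h_7(\mathbf z)=f_k-f_{k+1}-\frac{2\epsilon(1-\delta)^2}{L}\left(\frac{1-\delta}{(1+\delta)^2}-(1-\epsilon)\right)\|\mathbf g_k\|^2,$$ and the inequality $h_7\ge0$ is satisfied by the iterates of the method. The bound $f_{k+1}-f_*\le t(f_k-f_* )$ admits an SOS certificate of degree 1 if there are scalars $\sigma_1,\dots,\sigma_7\ge0$ and a polynomial $\sigma_0(\mathbf z)$ that is a sum of squares of polynomials of degree at most 1 such that, as an identity of polynomials in $\mathbf z$ (with $\mathbf g_*=0$), $$t(f_k-f_* )-(f_{k+1}-f_* )=\sigma_0(\mathbf z)+\sum_{i=1}^7\sigma_ih_i(\mathbf z).$$ *)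

(* Defs.v *)
From HB Require Import structures.
From mathcomp Require Import all_boot all_order all_algebra.
From mathcomp Require Import all_classical all_reals all_analysis.
(* The notations of mpoly clash with those of the analysis library. *)
From mathcomp Require Import -(notations) mpoly.

Set Implicit Arguments.
Unset Strict Implicit.
Unset Printing Implicit Defensive.

Import Order.TTheory GRing.Theory Num.Theory.
Import numFieldNormedType.Exports.

Local Open Scope ring_scope.

(* Generic in the ring, so as to serve for vectors of reals and for vectors of
   polynomials. *)
Definition dot (A : nzRingType) (n : nat) (u v : 'rV[A]_n) : A :=
  \sum_(j < n) u 0 j * v 0 j.

Definition sqnorm (A : nzRingType) (n : nat) (u : 'rV[A]_n) : A := dot u u.

(* The library norm `|u| on 'rV[R]_n is the sup norm. It induces the same
   topology, so the library notion of differentiability is the usual one. *)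
Definition enorm (R : realType) (n : nat) (u : 'rV[R]_n) : R :=
  Num.sqrt (sqnorm u).

(* The gradient of f at x wherever f is differentiable at x: the vector of its
   partial derivatives. *)
Definition grad (R : realType) (n : nat) (f : 'rV[R]_n -> R) (x : 'rV[R]_n) :
    'rV[R]_n :=
  \row_(j < n) 'D_(delta_mx 0 j) f x.

Definition strongly_smooth (R : realType) (n : nat) (mu L : R)
    (f : 'rV[R]_n -> R) : Prop :=
  [/\ convex_function [set: 'rV[R]_n]%classic f,
      forall x, differentiable f x,
      forall x y, enorm (grad f x - grad f y) <= L * enorm (x - y) &
      convex_function [set: 'rV[R]_n]%classic
        (fun x => f x - mu / 2 * enorm x ^+ 2)].

Definition global_minimizer (R : realType) (n : nat) (f : 'rV[R]_n -> R)
    (xs : 'rV[R]_n) : Prop :=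
  forall y, f xs <= f y.

Definition noisy_gradient_step (R : realType) (n : nat) (delta : R)
    (f : 'rV[R]_n -> R) (gamma : R) (x d x' : 'rV[R]_n) : Prop :=
  [/\ 0 < gamma,
      enorm (d - (- grad f x)) <= delta * enorm (grad f x) &
      x' = x + gamma *: d].

Definition goldstein_rule (R : realType) (n : nat) (eps : R)
    (f : 'rV[R]_n -> R) (gamma : R) (x d : 'rV[R]_n) : Prop :=
  - (1 - eps) * gamma * enorm d ^+ 2 <= f (x + gamma *: d) - f x
  /\ f (x + gamma *: d) - f x <= - eps * gamma * enorm d ^+ 2.

(* Labels of the points: the two iterates x_k, x_(k+1), and the minimizer. *)
Inductive iterate := Cur | Nxt.

Definition bool_of_iterate (i : iterate) : bool := if i is Nxt then true else false.
Definition iterate_of_bool (b : bool) : iterate := if b then Nxt else Cur.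
Lemma bool_of_iterateK : cancel bool_of_iterate iterate_of_bool.
Proof. by case. Qed.
HB.instance Definition _ := Finite.copy iterate (can_type bool_of_iterateK).

Definition point : Type := option iterate.
Definition star : point := None.
Definition cur : point := Some Cur.
Definition nxt : point := Some Nxt.

(* Scalar variables of z: the values f_i, the coordinates of the x_i, and the
   coordinates of the g_i, the latter for the two iterates only since g_* = 0
   is substituted. *)
Definition zvar (n : nat) : finType :=
  (option iterate + option iterate * 'I_n + iterate * 'I_n)%type.

Definition zpoly (R : realType) (n : nat) := mpoly #|zvar n| R.

Definition zX (R : realType) (n : nat) (v : zvar n) : zpoly R n :=
  mpolyX R (mnm1 (enum_rank v)).

Definition fZ (R : realType) (n : nat) (i : point) : zpoly R n :=
  @zX R n (inl (inl i)).

Definition xZ (R : realType) (n : nat) (i : point) : 'rV[zpoly R n]_n :=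
  \row_(j < n) @zX R n (inl (inr (i, j))).

Definition gZ (R : realType) (n : nat) (i : point) : 'rV[zpoly R n]_n :=
  if i is Some i' then \row_(j < n) @zX R n (inr (i', j)) else 0.

Definition hinterp (R : realType) (n : nat) (mu L : R) (i j : point) :
    zpoly R n :=
  fZ R n i - fZ R n j - dot (gZ R n j) (xZ R n i - xZ R n j)
  - (L / (2 * (L - mu))) *:
      (L^-1 *: sqnorm (gZ R n i - gZ R n j)
       + mu *: sqnorm (xZ R n i - xZ R n j)
       - (2 * (mu / L)) *: dot (gZ R n j - gZ R n i) (xZ R n j - xZ R n i)).

Definition hdecrease (R : realType) (n : nat) (L delta eps : R) : zpoly R n :=
  fZ R n cur - fZ R n nxt
  - (2 * eps * (1 - delta) ^+ 2 / L
     * ((1 - delta) / (1 + delta) ^+ 2 - (1 - eps))) *: sqnorm (gZ R n cur).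

Definition constraints (R : realType) (n : nat) (mu L delta eps : R) :
    7.-tuple (zpoly R n) :=
  [tuple hinterp n mu L cur nxt;
         hinterp n mu L cur star;
         hinterp n mu L nxt cur;
         hinterp n mu L nxt star;
         hinterp n mu L star cur;
         hinterp n mu L star nxt;
         hdecrease n L delta eps].

(* msize is one more than the total degree (and 0 for the null polynomial). *)
Definition sos_certificate_deg1 (R : realType) (n m : nat)
    (h : m.-tuple (zpoly R n)) (t : R) : Prop :=
  exists (sigma : 'I_m -> R) (sigma0 : zpoly R n),
    [/\ forall i, 0 <= sigma i,
        exists2 s : seq (zpoly R n),
          forall q, q \in s -> (msize q <= 2)%N
          & sigma0 = \sum_(q <- s) q ^+ 2 &
        t *: (fZ R n cur - fZ R n star) - (fZ R n nxt - fZ R n star)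
        = sigma0 + \sum_(i < m) sigma i *: tnth h i].

(* The values taken by z on the function f at the points xs, x and x'. *)
Definition zval (R : realType) (n : nat) (f : 'rV[R]_n -> R)
    (xs x x' : 'rV[R]_n) : 'I_#|zvar n| -> R :=
  let pt (i : point) :=
    match i with None => xs | Some Cur => x | Some Nxt => x' end in
  fun v => match (enum_val v : option iterate + option iterate * 'I_n
                               + iterate * 'I_n)%type with
           | inl (inl i) => f (pt i)
           | inl (inr (i, j)) => pt i 0 j
           | inr (i, j) => grad f (pt (Some i)) 0 j
           end.

Definition valid_constraints (R : realType) (n m : nat)
    (h : m.-tuple (zpoly R n)) (f : 'rV[R]_n -> R) (xs x x' : 'rV[R]_n) :
    Prop :=
  forall i : 'I_m, 0 <= meval (zval f xs x x') (tnth h i).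

(* Main.v *)
Require Import Defs.
From HB Require Import structures.
From mathcomp Require Import all_boot all_order all_algebra.
From mathcomp Require Import all_classical all_reals all_analysis.
From mathcomp Require Import -(notations) mpoly.
From mathcomp Require Import ring lra.
Import Order.TTheory GRing.Theory Num.Theory.
Import numFieldNormedType.Exports.
Local Open Scope classical_set_scope.
Local Open Scope ring_scope.
Set Implicit Arguments.
Unset Strict Implicit.
Unset Printing Implicit Defensive.

(** The bound is a combination of only two of the seven constraints. Write g
    for the gradient at the current iterate, w for the vector from the minimizer
    to it, and c for the coefficient of |g|^2 in h_7, so that the contraction
    factor is t = 1 - 2 mu c. The constraint h_7 >= 0 says that the step decreases
    f by at least c |g|^2, so a contraction follows from the Polyak-Lojasiewicz
    inequality |g|^2 >= 2 mu (f - f_star). The latter is certified by the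
    interpolation inequality for the pair (minimizer, current iterate): 2 mu times
    that polynomial falls short of |g|^2 - 2 mu (f - f_star) by
    L / (L - mu) |g - mu w|^2, a sum of squares of linear forms. Hence the
    multipliers 1 for h_7 and 2 mu c for the interpolation inequality.
    The resulting identity is [certificate_identity]; since evaluation at a point is a
    ring morphism, the numerical bound follows from the certificate and the
    validity of the constraints ([certificate_sound]).

    Validity needs analysis. A function that is L-smooth and mu-strongly convex
    lies between two quadratics tangent to it at any point: the upper one, of
    curvature L, is the descent lemma ([descent]), obtained from the mean value
    theorem on a segment; the lower one, of curvature mu, comes from dividing the
    convexity inequality by the step and letting it tend to 0
    ([strong_convexity_gradient]). Comparing the lower quadratic at x with the
    upper one at y, at the point where their gap is extremal, yields the
    interpolation inequalities ([interpolation]). The upper quadratic also shows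
    that the gradient vanishes at a minimizer, which is what allows substituting
    g_star = 0.

    For h_7, the noise condition controls |d| and - g . d in terms of |g|
    ([noisy_direction]). The lower Goldstein inequality against the descent lemma
    forces a step size of at least 2 / L ((1 - delta) / (1 + delta)^2
    - (1 - eps)), and the upper one turns that into a decrease proportional
    to |g|^2 ([goldstein_decrease]). *)

(** * Inner product and Euclidean norm *)

Section Dot.
Variables (A : comNzRingType) (n : nat).
Implicit Types u v w : 'rV[A]_n.

Lemma dotC u v : dot u v = dot v u.
Proof. by apply: eq_bigr => j _; rewrite mulrC. Qed.

Lemma dotDl u v w : dot (u + v) w = dot u w + dot v w.
Proof. by rewrite -big_split; apply: eq_bigr => j _; rewrite mxE mulrDl. Qed.

Lemma dotZl (a : A) u v : dot (a *: u) v = a * dot u v.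
Proof. by rewrite /dot mulr_sumr; apply: eq_bigr => j _; rewrite mxE mulrA. Qed.

Lemma dotNl u v : dot (- u) v = - dot u v.
Proof. by rewrite -scaleN1r dotZl mulN1r. Qed.

Lemma dotDr u v w : dot u (v + w) = dot u v + dot u w.
Proof. by rewrite dotC dotDl !(dotC _ u). Qed.

Lemma dotZr (a : A) u v : dot u (a *: v) = a * dot u v.
Proof. by rewrite dotC dotZl dotC. Qed.

Lemma dotNr u v : dot u (- v) = - dot u v.
Proof. by rewrite dotC dotNl dotC. Qed.

Definition dotE := (dotDl, dotDr, dotNl, dotNr, dotZl, dotZr).

Lemma sqnormN u : sqnorm (- u) = sqnorm u.
Proof. by rewrite /sqnorm dotNl dotNr opprK. Qed.

Lemma map_dot (B : nzRingType) (phi : {rmorphism A -> B}) u v :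
  phi (dot u v) = dot (map_mx phi u) (map_mx phi v).
Proof. by rewrite rmorph_sum; apply: eq_bigr => j _; rewrite rmorphM !mxE. Qed.

End Dot.

Section Norm.
Variables (R : realType) (n : nat).
Implicit Types u v : 'rV[R]_n.

Lemma sqnorm_ge0 u : 0 <= sqnorm u.
Proof. by apply: sumr_ge0 => j _; rewrite -expr2 sqr_ge0. Qed.

Lemma enorm_ge0 u : 0 <= enorm u.
Proof. exact: sqrtr_ge0. Qed.

Lemma sqr_enorm u : enorm u ^+ 2 = sqnorm u.
Proof. by rewrite sqr_sqrtr // sqnorm_ge0. Qed.

Lemma sqnorm_eq0 u : sqnorm u = 0 -> u = 0.
Proof.
move=> u0; apply/rowP => j; rewrite mxE; apply/eqP; rewrite -sqrf_eq0 expr2.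
move/eqP: u0; rewrite /sqnorm /dot psumr_eq0; last first.
  by move=> i _; rewrite -expr2 sqr_ge0.
by move=> /allP /(_ j (mem_index_enum j)).
Qed.

(** Cauchy-Schwarz: for nonzero u and v, expand the squared norm of
    |v| u - |u| v. *)
Lemma dot_le_enorm u v : dot u v <= enorm u * enorm v.
Proof.
have [u0|u_neq0] := eqVneq (enorm u) 0.
  have -> : u = 0 by apply: sqnorm_eq0; rewrite -sqr_enorm u0 expr0n.
  by rewrite -(scale0r 0) dotZl mul0r mulr_ge0 ?enorm_ge0.
have [v0|v_neq0] := eqVneq (enorm v) 0.
  have -> : v = 0 by apply: sqnorm_eq0; rewrite -sqr_enorm v0 expr0n.
  by rewrite -(scale0r 0) dotZr mul0r mulr_ge0 ?enorm_ge0.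
have uv_gt0 : 0 < enorm u * enorm v.
  by rewrite mulr_gt0 // lt0r ?u_neq0 ?v_neq0 enorm_ge0.
have := sqnorm_ge0 (enorm v *: u - enorm u *: v).
have -> : sqnorm (enorm v *: u - enorm u *: v) =
    2 * (enorm u * enorm v) * (enorm u * enorm v - dot u v).
  by rewrite /sqnorm !dotE -/(sqnorm u) -/(sqnorm v) (dotC v u) -!sqr_enorm; ring.
have two_uv_gt0 : 0 < 2 * (enorm u * enorm v) by rewrite mulr_gt0.
by rewrite (pmulr_rge0 _ two_uv_gt0) subr_ge0.
Qed.

End Norm.

(** * Differentiation along a line *)

Section Calculus.
Variables (R : realType) (n : nat) (f : 'rV[R]_n -> R).
Hypothesis df : forall x, differentiable f x.
Implicit Types x v : 'rV[R]_n.

(** The gradient is defined by partial derivatives, which determine the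
    differential because it is linear. *)
Lemma derive_grad x v : 'D_v f x = dot (grad f x) v.
Proof.
rewrite deriveE //; rewrite [v in LHS]row_sum_delta linear_sum; apply: eq_bigr => j _.
by rewrite linearZ -deriveE // !mxE mulrC.
Qed.

Lemma is_derive_line x v (t : R) :
  is_derive t 1 (fun s => f (x + s *: v)) (dot (grad f (x + t *: v)) v).
Proof.
have quotientE : (fun h : R => h^-1 *: (f (x + (h *: 1 + t) *: v) - f (x + t *: v)))
    = (fun h => h^-1 *: (f (h *: v + (x + t *: v)) - f (x + t *: v))).
  by apply/funext => h; rewrite [h *: 1]mulr1 scalerDl addrCA.
have := diff_derivable (v := v) (df (x + t *: v)).
rewrite -derive_grad /derivable -quotientE => dfv.
by apply: DeriveDef; rewrite // /derive quotientE.
Qed.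

(** The increments of f on the ray, divided by t, are at most u up to an error
    t * c; that error vanishes as t tends to 0 from the right. *)
Lemma grad_le_increment x v (u c : R) :
  (forall t, 0 < t -> t < 1 -> f (x + t *: v) - f x <= t * (u + t * c)) ->
  dot (grad f x) v <= u.
Proof.
move=> le_incr; rewrite -derive_grad.
pose q (h : R) := h^-1 *: (f (h *: v + x) - f x) - h * c.
have q_lim : (q @ 0^'+ --> 'D_v f x).
  apply: cvg_dnbhs_at_right.
  rewrite -[X in (_ --> X)]subr0.
  rewrite -[X in (_ --> _ - X)](mul0r c).
  apply: (@cvgB R R^o R _ _ (fun h => h^-1 *: (f (h *: v + x) - f x))).
    exact: (diff_derivable (v := v) (df x)).
  by apply: cvg_within_filter; apply: cvgMl; exact: cvg_id.
apply: (cvgr_to_le q_lim); near=> h.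
have h_gt0 : 0 < h by near: h; exact: nbhs_right_gt.
have h_lt1 : h < 1 by near: h; exact: nbhs_right_lt.
rewrite /q lerBlDr -ler_pdivlMl ?invr_gt0 // invrK addrC [h *: v + x]addrC.
by have := le_incr h h_gt0 h_lt1; lra.
Unshelve. all: by end_near. Qed.

End Calculus.

(** * Quadratic bounds *)

Section Smooth.
Variables (R : realType) (n : nat) (f : 'rV[R]_n -> R).
Hypothesis df : forall x, differentiable f x.
Implicit Types x v : 'rV[R]_n.

(** The gap between f and its upper quadratic model has a nonpositive derivative
    along the segment: by Cauchy-Schwarz, the gradient cannot gain more than
    t L |v|^2 in the direction v after a displacement t v. *)
Lemma descent (L : R) (L_gt0 : 0 < L)
    (lip : forall x y, enorm (grad f x - grad f y) <= L * enorm (x - y)) x v :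
  f (x + v) <= f x + dot (grad f x) v + L / 2 * sqnorm v.
Proof.
pose gap (t : R) :=
  f (x + t *: v) - t * dot (grad f x) v - t ^+ 2 * (L / 2 * sqnorm v).
pose dgap (t : R) :=
  dot (grad f (x + t *: v)) v - dot (grad f x) v - 2 * t * (L / 2 * sqnorm v).
have gapD (t : R) : is_derive t 1 gap (dgap t).
  have := is_derive_line df x v t => fD.
  rewrite /gap; apply: is_derive_eq; rewrite /dgap.
  by rewrite /GRing.scale /=; ring.
have gap_cont : {within `[0, 1], continuous gap}.
  apply: derivable_within_continuous => t _; exact: (@ex_derive _ _ _ _ _ _ _ (gapD t)).
have [t t01] := MVT ltr01 (fun t _ => gapD t) gap_cont.
rewrite /gap /dgap !scale1r !scale0r addr0.
have t_gt0 : 0 < t by move: t01; rewrite in_itv /= => /andP [].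
suff : dot (grad f (x + t *: v)) v - dot (grad f x) v <= t * L * sqnorm v by lra.
have -> : dot (grad f (x + t *: v)) v - dot (grad f x) v =
    dot (grad f (x + t *: v) - grad f x) v by rewrite !dotE.
apply: (le_trans (dot_le_enorm _ _)).
have enormZ : enorm (t *: v) = t * enorm v.
  by rewrite /enorm /sqnorm !dotE mulrA -expr2 sqrtrM ?sqr_ge0 // sqrtr_sqr gtr0_norm.
rewrite -sqr_enorm expr2 mulrA ler_wpM2r ?enorm_ge0 //.
by apply: (le_trans (lip _ _)); rewrite addrC addKr enormZ; lra.
Qed.

(** Convexity of f - mu/2 |.|^2 on the segment bounds f (x + t v) - f x by
    t (f (x + v) - f x - mu/2 (1 - t) |v|^2). *)
Lemma strong_convexity_gradient (mu : R)
    (cvx : convex_function [set: 'rV[R]_n]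
        (fun x => f x - mu / 2 * enorm x ^+ 2)) x v :
  f x + dot (grad f x) v + mu / 2 * sqnorm v <= f (x + v).
Proof.
suff : dot (grad f x) v <= f (x + v) - f x - mu / 2 * sqnorm v by lra.
apply: (grad_le_increment df (c := mu / 2 * sqnorm v)) => t t_gt0 t_lt1.
pose t' : {i01 R} := Itv01 (ltW t_gt0) (ltW t_lt1).
have := cvx t' (x + v) x (in_setT _) (in_setT _).
have -> : conv t' (x + v : convex_lmodType 'rV[R]_n) x = x + t *: v.
  by rewrite /conv /= /unstable.onem scalerDr addrAC -scalerDl addrC subrKC scale1r addrC.
rewrite convRE /= /unstable.onem !sqr_enorm /sqnorm !dotE (dotC v x); lra.
Qed.

End Smooth.

(** * Interpolation inequalities *)

Section Interpolation.
Variables (R : realType) (n : nat) (mu L : R) (f : 'rV[R]_n -> R).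
Hypotheses (mu_ge0 : 0 <= mu) (mu_lt_L : mu < L).
Hypothesis f_smooth : strongly_smooth mu L f.

Lemma smooth_upper x v :
  f (x + v) <= f x + dot (grad f x) v + L / 2 * sqnorm v.
Proof.
by case: f_smooth => _ df lip _; apply: descent => //; exact: le_lt_trans mu_lt_L.
Qed.

Lemma smooth_lower x v :
  f x + dot (grad f x) v + mu / 2 * sqnorm v <= f (x + v).
Proof.
by case: f_smooth => _ df _ cvx; exact: strong_convexity_gradient.
Qed.

(** A gradient step of length 1 / L from xs would decrease f by at least
    |grad f xs|^2 / (2 L). *)
Lemma grad_minimizer xs : global_minimizer f xs -> grad f xs = 0.
Proof.
move=> xs_min; apply: sqnorm_eq0; apply/eqP; rewrite eq_le sqnorm_ge0 andbT.
have L_gt0 : 0 < L by exact: le_lt_trans mu_lt_L.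
have := le_trans (xs_min _) (smooth_upper xs (- L^-1 *: grad f xs)).
rewrite /sqnorm !dotE -/(sqnorm _).
have -> : L / 2 * (- L^-1 * (- L^-1 * sqnorm (grad f xs))) =
    L^-1 * sqnorm (grad f xs) / 2.
  by field; rewrite gt_eqF.
move=> le_f; have : L^-1 * sqnorm (grad f xs) <= 0 by lra.
by rewrite pmulr_rle0 ?invr_gt0.
Qed.

(** With p = grad f y - grad f x and w = y - x, the lower quadratic at x minus
    the upper quadratic at y is a concave quadratic function of the point, of
    curvature - (L - mu), which is nonpositive everywhere; the inequality says
    that its maximal value is. *)
Lemma interpolation x y :
  0 <= f y - f x - dot (grad f x) (y - x)
  - L / (2 * (L - mu)) *
      (L^-1 * sqnorm (grad f y - grad f x) + mu * sqnorm (y - x)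
       - 2 * (mu / L) * dot (grad f x - grad f y) (x - y)).
Proof.
set p := grad f y - grad f x; set w := y - x.
have L_gt0 : 0 < L by exact: le_lt_trans mu_lt_L.
have D_gt0 : 0 < L - mu by rewrite subr_gt0.
(* y - q is the point where the gradients of the two quadratics agree. *)
pose q := (L - mu)^-1 *: (p - mu *: w).
have lower := smooth_lower x (w - q); have upper := smooth_upper y (- q).
have yE : y - q = x + (w - q) by rewrite addrA subrKC.
rewrite yE in upper.
have {lower upper yE} := le_trans lower upper.
have gyE : grad f y = p + grad f x by rewrite subrK.
have -> : dot (grad f x - grad f y) (x - y) = dot p w.
  by rewrite -(opprB y x) -(opprB (grad f y)) dotNl dotNr opprK.
clearbody p w; rewrite gyE /q /sqnorm !dotE (dotC w p) -!/(sqnorm _).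
rewrite -subr_ge0; congr (0 <= _).
by field; rewrite !gt_eqF.
Qed.

End Interpolation.

(** * Decrease of a noisy step under the Goldstein rule *)

Definition decrease_rate (R : realType) (L delta eps : R) : R :=
  2 * eps * (1 - delta) ^+ 2 / L * ((1 - delta) / (1 + delta) ^+ 2 - (1 - eps)).

Lemma goldstein_parameter_gt0 (R : realType) (delta eps : R) :
  0 <= delta -> 1 - (1 - delta) / (1 + delta) ^+ 2 < eps -> 0 < eps.
Proof.
move=> delta_ge0; apply: le_lt_trans; rewrite subr_ge0.
have sq_gt0 : 0 < (1 + delta) ^+ 2 by rewrite exprn_gt0 //; lra.
have sq_ge0 := sqr_ge0 delta.
by rewrite ler_pdivrMr //; lra.
Qed.

Lemma decrease_rate_ge0 (R : realType) (L delta eps : R) :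
  0 < L -> 0 <= delta -> 1 - (1 - delta) / (1 + delta) ^+ 2 < eps ->
  0 <= decrease_rate L delta eps.
Proof.
move=> L_gt0 delta_ge0 eps_gt.
have e_gt0 := goldstein_parameter_gt0 delta_ge0 eps_gt.
rewrite /decrease_rate mulr_ge0 //; last by lra.
by rewrite divr_ge0 ?(ltW L_gt0) // mulr_ge0 ?sqr_ge0 //; lra.
Qed.

(** The error e = d + g satisfies |e| <= delta |g|, so that d is - g up to a
    relative error delta. *)
Lemma noisy_direction (R : realType) (n : nat) (delta : R) (g d : 'rV[R]_n) :
  0 <= delta -> delta < 1 -> enorm (d - - g) <= delta * enorm g ->
  [/\ (1 - delta) * sqnorm g <= - dot g d,
      (1 - delta) ^+ 2 * sqnorm g <= sqnorm d &
      sqnorm d <= (1 + delta) ^+ 2 * sqnorm g].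
Proof.
move=> delta_ge0 delta_lt1; rewrite opprK; set e := d + g => e_le.
have dE : d = e - g by rewrite addrK.
have g_ge0 := enorm_ge0 g; have e_ge0 := enorm_ge0 e.
have eg : dot e g <= enorm e * enorm g by exact: dot_le_enorm.
have eNg : - dot e g <= enorm e * enorm g.
  by rewrite -dotNl (le_trans (dot_le_enorm _ _)) // /enorm /sqnorm !dotE opprK.
clearbody e; rewrite {}dE /sqnorm !dotE (dotC g e) -!/(sqnorm _) -!sqr_enorm.
move: (enorm g) (enorm e) (dot e g) g_ge0 e_ge0 eg eNg e_le.
move=> a b c a_ge0 b_ge0 c_le cN_le b_le.
have ba_le : b * a <= delta * a * a by rewrite ler_wpM2r.
have ba : b <= a by nra.
have near_sq : ((1 - delta) * a) ^+ 2 <= (a - b) ^+ 2.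
  by rewrite ler_pXn2r ?nnegrE ?mulr_ge0 //; lra.
have far_sq : (a + b) ^+ 2 <= ((1 + delta) * a) ^+ 2.
  by rewrite ler_pXn2r ?nnegrE ?addr_ge0 ?mulr_ge0 ?addr_ge0 //; lra.
by split; lra.
Qed.

(** Subtracting the lower Goldstein inequality from the descent lemma and using
    - g . d >= (1 - delta) / (1 + delta)^2 |d|^2 gives a multiple of |d|^2 on
    both sides, whence a lower bound on gamma unless d = 0, in which case the
    gradient vanishes too. The upper Goldstein inequality concludes. *)
Lemma goldstein_decrease (R : realType) (n : nat) (mu L delta eps gamma : R)
    (f : 'rV[R]_n -> R) (x d x' : 'rV[R]_n) :
  0 <= mu -> mu < L -> 0 <= delta -> delta < 1 ->
  1 - (1 - delta) / (1 + delta) ^+ 2 < eps -> strongly_smooth mu L f ->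
  noisy_gradient_step delta f gamma x d x' -> goldstein_rule eps f gamma x d ->
  decrease_rate L delta eps * sqnorm (grad f x) <= f x - f x'.
Proof.
move=> mu_ge0 mu_lt_L delta_ge0 delta_lt1 eps_gt f_smooth.
move=> [gamma_gt0 /(noisy_direction delta_ge0 delta_lt1) [gd_ge d_ge d_le] ->] [low up].
have L_gt0 : 0 < L by exact: le_lt_trans mu_lt_L.
have e_gt0 := goldstein_parameter_gt0 delta_ge0 eps_gt.
have smooth := smooth_upper mu_ge0 mu_lt_L f_smooth x (gamma *: d).
rewrite !sqr_enorm in low up.
rewrite {1}/sqnorm !dotE -/(sqnorm d) in smooth.
move: (sqnorm (grad f x)) (sqnorm_ge0 (grad f x)) gd_ge d_ge d_le => G G_ge0.
move: (sqnorm d) (sqnorm_ge0 d) low up smooth => S S_ge0.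
move: (dot _ d) (f (x + _)) (f x) => P f' f0 low up smooth gd_ge d_ge d_le.
pose kappa := (1 - delta) / (1 + delta) ^+ 2 - (1 - eps).
have rS : (1 - delta) / (1 + delta) ^+ 2 * S <= - P.
  apply: le_trans gd_ge; rewrite -mulrA ler_wpM2l ?subr_ge0 ?(ltW delta_lt1) //.
  by rewrite ler_pdivrMl ?exprn_gt0 //; lra.
have stepS : kappa * S <= L / 2 * gamma * S.
  have : gamma * (kappa * S) <= gamma * (L / 2 * gamma * S).
    by rewrite /kappa; nra.
  by rewrite ler_pM2l.
have [S0|S_neq0] := eqVneq S 0.
  have sq_gt0 : 0 < (1 - delta) ^+ 2 by rewrite exprn_gt0 // subr_gt0.
  rewrite {}S0 ?(pmulr_rle0 _ sq_gt0) in up d_ge.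
  by have -> : G = 0; [apply/eqP; rewrite eq_le G_ge0 d_ge | lra].
have S_gt0 : 0 < S by rewrite lt0r S_neq0.
have step_ge : kappa <= L / 2 * gamma by rewrite ler_pM2r in stepS.
have kappa_gt0 : 0 < kappa by rewrite /kappa; lra.
apply: (@le_trans _ _ (eps * gamma * S)); last by lra.
have -> : decrease_rate L delta eps * G = eps * (2 / L * kappa) * ((1 - delta) ^+ 2 * G).
  by rewrite /decrease_rate -/kappa; field; rewrite gt_eqF.
have gamma_ge : 2 / L * kappa <= gamma.
  by rewrite mulrAC ler_pdivrMr //; lra.
apply: ler_pM => //; first by rewrite !mulr_ge0 ?invr_ge0 // ltW.
- by rewrite mulr_ge0 ?sqr_ge0.
- by rewrite ler_wpM2l // ltW.
Qed.

(** * Evaluation of polynomials at the iterates *)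

Lemma certificate_sound (R : realType) (n m : nat)
    (h : m.-tuple (zpoly R n)) (t : R) (f : 'rV[R]_n -> R) (xs x x' : 'rV[R]_n) :
  sos_certificate_deg1 h t -> valid_constraints h f xs x x' ->
  f x' - f xs <= t * (f x - f xs).
Proof.
move=> [sigma [sigma0 [sigma_ge0 [s _ ->] certE]]] h_ge0.
have {certE} := congr1 (meval (zval f xs x x')) certE.
rewrite mevalB mevalZ !mevalB /fZ /zX !mevalXU /zval !enum_rankK /= => certE.
rewrite -subr_ge0 certE rmorphD !rmorph_sum /= addr_ge0 //; apply: sumr_ge0 => i _.
  by rewrite rmorphXn sqr_ge0.
by rewrite mevalZ mulr_ge0 //; exact: h_ge0.
Qed.

(** The interpolation polynomial evaluated by an arbitrary morphism. Stating it
    over an abstract algebra keeps rewriting from comparing the instances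
    of the concrete polynomial ring, whose number of variables is a large term. *)
Lemma morph_interp_form (R : realType) (n : nat) (A : comAlgType R)
    (phi : {rmorphism A -> R}) (fi fj : A) (gi gj xi xj : 'rV[A]_n)
    (a b c e : R) (phiv := @map_mx _ _ phi 1 n) :
  (forall r p, phi (r *: p) = r * phi p) ->
  phi (fi - fj - dot gj (xi - xj)
    - a *: (b *: sqnorm (gi - gj) + c *: sqnorm (xi - xj)
            - e *: dot (gj - gi) (xj - xi))) =
  phi fi - phi fj - dot (phiv gj) (phiv xi - phiv xj)
  - a * (b * sqnorm (phiv gi - phiv gj)
         + c * sqnorm (phiv xi - phiv xj)
         - e * dot (phiv gj - phiv gi) (phiv xj - phiv xi)).
Proof.
move=> phiZ; rewrite /sqnorm !(rmorphB, rmorphD) !phiZ !(rmorphB, rmorphD) !phiZ.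
by rewrite !map_dot !map_mxB.
Qed.

Section Evaluation.
Variables (R : realType) (n : nat) (f : 'rV[R]_n -> R) (xs x x' : 'rV[R]_n).

Local Notation ev := (meval (zval f xs x x')).

Definition labelled_point (i : Defs.point) : 'rV[R]_n :=
  match i with None => xs | Some Cur => x | Some Nxt => x' end.

Lemma eval_fZ i : ev (fZ R n i) = f (labelled_point i).
Proof. by rewrite /fZ /zX mevalXU /zval enum_rankK. Qed.

Lemma eval_xZ i : map_mx ev (xZ R n i) = labelled_point i.
Proof. by apply/rowP => j; rewrite !mxE /zX mevalXU /zval enum_rankK. Qed.

Lemma eval_gZ i : grad f xs = 0 -> map_mx ev (gZ R n i) = grad f (labelled_point i).
Proof.
case: i => [i|] grad_xs /=; last by rewrite grad_xs map_mx0.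
by apply/rowP => j; rewrite mxE [_ 0 j]mxE /zX mevalXU /zval enum_rankK.
Qed.

Lemma eval_hinterp mu L i j (xi := labelled_point i) (xj := labelled_point j) :
  grad f xs = 0 ->
  ev (hinterp n mu L i j) =
  f xi - f xj - dot (grad f xj) (xi - xj)
  - L / (2 * (L - mu)) *
      (L^-1 * sqnorm (grad f xi - grad f xj) + mu * sqnorm (xi - xj)
       - 2 * (mu / L) * dot (grad f xj - grad f xi) (xj - xi)).
Proof.
move=> grad_xs; rewrite /hinterp (morph_interp_form (phi := ev)); last exact: mevalZ.
by rewrite /= 2!eval_fZ 2!eval_xZ (eval_gZ i) // (eval_gZ j).
Qed.

Lemma eval_hdecrease L delta eps : grad f xs = 0 ->
  ev (hdecrease n L delta eps) =
  f x - f x' - decrease_rate L delta eps * sqnorm (grad f x).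
Proof.
move=> grad_xs; rewrite mevalB mevalZ mevalB 2!eval_fZ.
by rewrite /sqnorm (map_dot ev) (eval_gZ cur).
Qed.

End Evaluation.

(** * The sum-of-squares certificate *)

Lemma sum_two_multipliers (R : nzRingType) (V : lmodType R) (b : R)
    (h1 h2 h3 h4 h5 h6 h7 : V) :
  \sum_(i < 7) [:: 0; 0; 0; 0; b; 0; 1]`_i *:
    tnth [tuple h1; h2; h3; h4; h5; h6; h7] i = b *: h5 + h7.
Proof.
rewrite !big_ord_recl big_ord0 !(tnth_nth 0) /=.
by rewrite !scale0r !add0r !addr0 scale1r.
Qed.

(** Here P = |g|^2, Q = g . w and S = |w|^2, and the parenthesis multiplied by
    2 mu c is the interpolation polynomial of the pair (minimizer, current
    iterate). Both sides are linear in these quantities, and their coefficients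
    agree thanks to the single relation 2 u (1 - mu / L) = 1 satisfied by
    u = L / (2 (L - mu)). *)
Lemma certificate_identity (R : realType) (A : comAlgType R) (mu L c : R)
    (P Q S f0 f1 fs : A) : 0 < L -> mu < L ->
  (1 - 2 * mu * c) *: (f0 - fs) - (f1 - fs) =
  (c * (L / (L - mu))) *: (P - (2 * mu) *: Q + mu ^+ 2 *: S)
  + ((2 * mu * c) *:
       (fs - f0 + Q - L / (2 * (L - mu)) *:
                        (L^-1 *: P + mu *: S - (2 * (mu / L)) *: Q))
     + (f0 - f1 - c *: P)).
Proof.
move=> L_gt0 mu_lt_L.
have L_neq0 : L != 0 by rewrite gt_eqF.
have D_neq0 : L - mu != 0 by rewrite subr_eq0 gt_eqF.
pose u := L / (2 * (L - mu)).
have rel : 2 * u * (1 - mu * L^-1) = 1 by rewrite /u; field; rewrite L_neq0.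
have -> : L / (L - mu) = 2 * u by rewrite /u; field.
rewrite -/u; clearbody u.
(* The scaling is moved inside A, where ring can normalize both sides. *)
have [phi scaleE] :
    exists phi : {rmorphism R -> A}, forall a x, a *: x = phi a * x.
  by exists (in_alg A) => a x; rewrite mulr_algl.
rewrite !scaleE; apply/eqP; rewrite -subr_eq0; apply/eqP.
transitivity ((1 - phi (2 * u * (1 - mu * L^-1)))
              * (phi c * P - 2 * phi mu * phi c * Q)).
  ring.
by rewrite rel rmorph1 subrr mul0r.
Qed.
Section Certificate.
Variables (R : realType) (n : nat).

Lemma sos_sqnorm (a mu : R) (g w : 'rV[zpoly R n]_n) : 0 <= a ->
  \sum_(q <- [seq Num.sqrt a *: (g 0 j - mu *: w 0 j) | j <- enum 'I_n]) q ^+ 2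
  = a *: (sqnorm g - (2 * mu) *: dot g w + mu ^+ 2 *: sqnorm w).
Proof.
move=> a_ge0; rewrite big_map big_enum /= -[in RHS](sqr_sqrtr a_ge0).
rewrite /sqnorm /dot !scaler_sumr -sumrB -big_split /= scaler_sumr.
apply: eq_bigr => j _.
rewrite exprZn sqrrB; congr (_ *: (_ + _)).
  by rewrite expr2 -scalerAr -scaler_nat scalerA.
by rewrite exprZn expr2.
Qed.

Lemma msize_affine (a mu : R) (u v w : zvar n) :
  (msize (a *: (zX R u - mu *: (zX R v - zX R w))) <= 2)%N.
Proof.
have szX v' : (msize (zX R v') <= 2)%N by rewrite /zX msizeX mdeg1.
have szZ b p : (msize p <= 2 -> msize (b *: p : zpoly R n) <= 2)%N.
  by move=> h; exact: leq_trans (msizeZ_le _ _) h.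
have szB p q : (msize p <= 2 -> msize q <= 2 -> msize (p - q : zpoly R n) <= 2)%N.
  move=> hp hq; apply: leq_trans (msizeD_le _ _) _.
  by rewrite geq_max hp msizeN.
by rewrite szZ // szB // szZ // szB.
Qed.

Lemma hinterp_star_cur mu L (w := xZ R n cur - xZ R n star) :
  hinterp n mu L star cur =
  fZ R n star - fZ R n cur + dot (gZ R n cur) w
  - (L / (2 * (L - mu))) *: (L^-1 *: sqnorm (gZ R n cur) + mu *: sqnorm w
     - (2 * (mu / L)) *: dot (gZ R n cur) w).
Proof.
rewrite /hinterp -(opprB (xZ R n cur)) -/w [gZ R n star]/(0 : 'rV_n).
move: (gZ R n cur) w (fZ R n cur) (fZ R n star) => g w f0 fs.
by rewrite (subr0 g) (sub0r g) 2!sqnormN dotNr (opprK (dot g w)).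
Qed.

(** The multipliers are 2 mu c for the pair (minimizer, current iterate) and 1
    for the decrease; the square is split into the coordinates of
    sqrt a (g - mu w), with a = c L / (L - mu). *)
Lemma certificate_exists (mu L delta eps : R) :
  0 <= mu -> mu < L -> 0 <= decrease_rate L delta eps ->
  sos_certificate_deg1 (constraints n mu L delta eps)
    (1 - 2 * mu * decrease_rate L delta eps).
Proof.
move=> mu_ge0 mu_lt_L; rewrite /constraints /hdecrease -/(decrease_rate L delta eps).
move: (decrease_rate L delta eps) => c c_ge0.
have L_gt0 : 0 < L by exact: le_lt_trans mu_lt_L.
have D_gt0 : 0 < L - mu by rewrite subr_gt0.
pose a := c * (L / (L - mu)).
have a_ge0 : 0 <= a by rewrite mulr_ge0 ?divr_ge0 // ltW.
pose g := gZ R n cur; pose w := xZ R n cur - xZ R n star.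
pose sigma : seq R := [:: 0; 0; 0; 0; 2 * mu * c; 0; 1].
exists (fun i => sigma`_i).
exists (\sum_(q <- [seq Num.sqrt a *: (g 0 j - mu *: w 0 j) | j <- enum 'I_n]) q ^+ 2).
split.
- have muc_ge0 : 0 <= 2 * mu * c by rewrite !mulr_ge0.
  by do 7?[case=> [//|]]; case; do 7?[case=> //].
- exists [seq Num.sqrt a *: (g 0 j - mu *: w 0 j) | j <- enum 'I_n] => // q.
  by case/mapP => j _ ->; rewrite !mxE; exact: msize_affine.
rewrite (sos_sqnorm _ _ _ a_ge0) /constraints sum_two_multipliers hinterp_star_cur.
exact: certificate_identity.
Qed.

End Certificate.

Theorem theorem5 (R : realType) (n : nat) (mu L delta eps : R)
    (mu_ge0 : 0 <= mu) (mu_lt_L : mu < L)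
    (delta_ge0 : 0 <= delta) (delta_lt : delta < Num.sqrt 5 - 2)
    (eps_gt : 1 - (1 - delta) / (1 + delta) ^+ 2 < eps) (eps_lt : eps < 1 / 2)
    (f : 'rV[R]_n -> R) (f_smooth : strongly_smooth mu L f)
    (xs : 'rV[R]_n) (xs_min : global_minimizer f xs)
    (x d : nat -> 'rV[R]_n) (gamma : nat -> R)
    (x_step : forall k : nat, (1 <= k)%N ->
       noisy_gradient_step delta f (gamma k) (x k) (d k) (x k.+1))
    (x_goldstein : forall k : nat, (1 <= k)%N ->
       goldstein_rule eps f (gamma k) (x k) (d k))
    (k : nat) (k_ge1 : (1 <= k)%N) :
  let t := 1 - 4 * mu * eps * (1 - delta) ^+ 2 / L
               * ((1 - delta) / (1 + delta) ^+ 2 - (1 - eps)) in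
  let h := constraints n mu L delta eps in
  [/\ f (x k.+1) - f xs <= t * (f (x k) - f xs),
      valid_constraints h f xs (x k) (x k.+1) &
      sos_certificate_deg1 h t].
Proof.
move=> t h.
have L_gt0 : 0 < L by exact: le_lt_trans mu_lt_L.
have delta_lt1 : delta < 1.
  have sqrt5_lt3 : Num.sqrt 5 < 3 :> R.
    rewrite -(ltr_pXn2r (n := 2)) ?nnegrE ?sqrtr_ge0 // sqr_sqrtr //; lra.
  by lra.
have tE : t = 1 - 2 * mu * decrease_rate L delta eps.
  by rewrite /t /decrease_rate; field; rewrite !gt_eqF //; lra.
have cert : sos_certificate_deg1 h t.
  by rewrite tE; apply: certificate_exists => //; exact: decrease_rate_ge0.
have valid : valid_constraints h f xs (x k) (x k.+1).
  have grad_xs := grad_minimizer mu_ge0 mu_lt_L f_smooth xs_min.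
  have interp i j : 0 <= meval (zval f xs (x k) (x k.+1)) (hinterp n mu L i j).
    by rewrite eval_hinterp //; exact: (interpolation mu_ge0 mu_lt_L f_smooth).
  have decrease : 0 <= meval (zval f xs (x k) (x k.+1)) (hdecrease n L delta eps).
    rewrite eval_hdecrease // subr_ge0.
    exact: (goldstein_decrease mu_ge0 mu_lt_L delta_ge0 delta_lt1 eps_gt f_smooth
              (x_step k k_ge1) (x_goldstein k k_ge1)).
  case; do 7?[case=> [lt7|]; first by rewrite (tnth_nth 0) /=].
  by [].
by split=> //; exact: certificate_sound cert valid.
Qed.
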